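(* Let $(\Sigma_+,\Sigma_-,N_1,N_2,N_3)$ be a solution, defined for all $\tau\in\mathbb{R}$, of the Wainwright–Hsu system (described in the context) satisfying the constraint, with $N_1<0$ and $N_2,N_3>0$. Then $$\lim_{\tau\to\infty}N_1=0,\quad \lim_{\tau\to\infty}N_2=\infty,\quad \lim_{\tau\to\infty}N_3=\infty,\quad \lim_{\tau\to\infty}\Sigma_+=\tfrac12,\quad \lim_{\tau\to\infty}\Sigma_-=0,$$ $$\lim_{\tau\to\infty}N_1(N_2+N_3)=-\tfrac12,\qquad \lim_{\tau\to\infty}(N_2-N_3)=0.$$
   Context: Wainwright–Hsu system: for functions $N_1,N_2,N_3,\Sigma_+,\Sigma_-$ of $\tau\in\mathbb{R}$ (prime denotes $d/d\tau$), $N_1'=(q-4\Sigma_+)N_1$, $N_2'=(q+2\Sigma_++2\sqrt3\Sigma_-)N_2$, $N_3'=(q+2\Sigma_+-2\sqrt3\Sigma_-)N_3$, $\Sigma_+'=-(2-q)\Sigma_+-3S_+$, $\Sigma_-'=-(2-q)\Sigma_--3S_-$, where $q=2(\Sigma_+^2+\Sigma_-^2)$, $S_+=\frac12[(N_2-N_3)^2-N_1(2N_1-N_2-N_3)]$, $S_-=\frac{\sqrt3}{2}(N_3-N_2)(N_1-N_2-N_3)$, together with the constraint $\Sigma_+^2+\Sigma_-^2+\frac34[N_1^2+N_2^2+N_3^2-2(N_1N_2+N_2N_3+N_1N_3)]=1$ (which is preserved by the flow). The signs of each $N_i$ (positive, negative, zero) are preserved by the flow. Solutions with these sign conditions (Bianchi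 VIII) exist for all $\tau\in\mathbb{R}$. *)

(* Defs.v *)
From Stdlib Require Import Reals.
From Coquelicot Require Import Coquelicot.
Open Scope R_scope.

Definition WH_q (sp sm : R) : R := 2 * (sp ^ 2 + sm ^ 2).

Definition WH_Splus (n1 n2 n3 : R) : R :=
  / 2 * ((n2 - n3) ^ 2 - n1 * (2 * n1 - n2 - n3)).

Definition WH_Sminus (n1 n2 n3 : R) : R :=
  sqrt 3 / 2 * (n3 - n2) * (n1 - n2 - n3).

Definition WH_system (N1 N2 N3 Sp Sm : R -> R) : Prop :=
  forall t : R,
    is_derive N1 t ((WH_q (Sp t) (Sm t) - 4 * Sp t) * N1 t) /\
    is_derive N2 t ((WH_q (Sp t) (Sm t) + 2 * Sp t + 2 * sqrt 3 * Sm t) * N2 t) /\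
    is_derive N3 t ((WH_q (Sp t) (Sm t) + 2 * Sp t - 2 * sqrt 3 * Sm t) * N3 t) /\
    is_derive Sp t (- (2 - WH_q (Sp t) (Sm t)) * Sp t - 3 * WH_Splus (N1 t) (N2 t) (N3 t)) /\
    is_derive Sm t (- (2 - WH_q (Sp t) (Sm t)) * Sm t - 3 * WH_Sminus (N1 t) (N2 t) (N3 t)).

Definition WH_constraint (N1 N2 N3 Sp Sm : R -> R) : Prop :=
  forall t : R,
    Sp t ^ 2 + Sm t ^ 2
    + 3 / 4 * (N1 t ^ 2 + N2 t ^ 2 + N3 t ^ 2
               - 2 * (N1 t * N2 t + N2 t * N3 t + N1 t * N3 t)) = 1.

(* Main.v *)
Require Import Defs.
From Stdlib Require Import Reals.
From Coquelicot Require Import Coquelicot.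
From Stdlib Require Import Lra Psatz.
Open Scope R_scope.

(** Write [a = -N1], [s = N2 + N3], [z = sqrt 3 / 2 * (N2 - N3)], [x = Sigma_+],
    [y = Sigma_-].  The pair [(y, z)] rotates at angular speed about [3 s], so
    [y^2] and [z^2] agree on average; precisely, [G = y z / s] satisfies
    [y^2 - z^2 = G' / 3 + O(1/s)].

    The increasing quantity [P = a (s^2 - 4/3 z^2)] has [(ln P)' = 3 q], and
    [x - 3/2 G + c ln P] has derivative at least [3/4] for large [c]; so [P] grows
    exponentially, and so does [s >= 3/2 P].  Next,
    [L = ln (a^2 (s^2 - 4/3 z^2)) - 4 ln (2 - x)] satisfies
    [L' = 4 / (2 - x) * ((1 - 2x)^2 + 9/4 a^2 + 3 (y^2 - z^2))], and the last term is
    removed, up to an exponentially small error, by subtracting [4 G / (2 - x)].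
    As [L] is bounded above, it converges and [x -> 1/2]; hence [a s] and
    [y^2 + z^2] converge too.  Finally [x - (x + 1) G / 3] converges, while its
    derivative tends to [-3/2 lim (y^2 + z^2)], which must therefore vanish. *)

(** * Limits at infinity of monotone, dissipative and exponentially small functions *)

Lemma is_lim_p_infty_spec (f : R -> R) (l : R) :
  is_lim f p_infty l <->
  (forall eps, 0 < eps -> exists M, forall t, M < t -> Rabs (f t - l) < eps).
Proof.
rewrite <- is_lim_spec; split.
- intros H eps He; exact (H (mkposreal eps He)).
- intros H eps; exact (H eps (cond_pos eps)).
Qed.

Lemma increment_lower_bound (f df : R -> R) (k u v : R) :
  u <= v ->
  (forall t, u <= t <= v -> is_derive f t (df t)) ->
  (forall t, u <= t <= v -> k <= df t) ->
  k * (v - u) <= f v - f u.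
Proof.
intros Huv Hd Hk.
destruct (MVT_gen f u v df) as [c [Hc E]].
- intros t Ht; rewrite Rmin_left, Rmax_right in Ht by lra; apply Hd; lra.
- intros t Ht; rewrite Rmin_left, Rmax_right in Ht by lra.
  apply continuity_pt_filterlim, (ex_derive_continuous (V := R_NormedModule)).
  eexists; apply Hd; lra.
- rewrite Rmin_left, Rmax_right in Hc by lra.
  rewrite E; specialize (Hk c Hc); nra.
Qed.

Lemma is_lim_nondecreasing_bounded (f : R -> R) (B : R) :
  (forall u v, 0 <= u <= v -> f u <= f v) ->
  (forall t, 0 <= t -> f t <= B) ->
  exists l : R, is_lim f p_infty l.
Proof.
intros Hm Hb.
destruct (completeness (fun v => exists t, 0 <= t /\ v = f t)) as [l [Hu Hl]].
- exists B; intros v [t [Ht ->]]; auto.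
- exists (f 0), 0; split; [lra | reflexivity].
- exists l; apply is_lim_p_infty_spec; intros eps He.
  destruct (Classical_Prop.classic (exists t, 0 <= t /\ l - eps < f t)) as [[t0 [H0 Ht0]] | Hn].
  + exists t0; intros t Ht.
    assert (f t0 <= f t) by (apply Hm; lra).
    assert (f t <= l) by (apply Hu; exists t; split; [lra | reflexivity]).
    apply Rabs_def1; lra.
  + assert (l <= l - eps); [| lra].
    apply Hl; intros v [t [Ht ->]].
    apply Rnot_lt_le; intro; apply Hn; exists t; split; lra.
Qed.

(** A Barbalat-type argument. If [g] is at distance at least [eps] from [c] at a late time [t], the
    bound [M] on its speed keeps it at distance at least [eps / 2] during a time [de = eps / (2 M)].
    Then [J] gains at least [k (eps / 2)^2 de = 2 eta], although both end values are within [eta] of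
    [l]. *)
Lemma is_lim_of_dissipation (J dJ g dg : R -> R) (k M c l : R) :
  0 < k -> 0 < M -> is_lim J p_infty l ->
  (forall t, 0 <= t -> is_derive J t (dJ t)) ->
  (forall t, 0 <= t -> k * (g t - c) ^ 2 <= dJ t) ->
  (forall t, 0 <= t -> is_derive g t (dg t)) ->
  (forall t, 0 <= t -> - M <= dg t <= M) ->
  is_lim g p_infty c.
Proof.
intros Hk HM HJ HdJ Hdis Hdg HMg.
apply is_lim_p_infty_spec; intros eps He.
set (de := eps / (2 * M)).
assert (Hde : 0 < de) by (apply Rdiv_lt_0_compat; lra).
assert (HMde : M * de = eps / 2) by (unfold de; field; lra).
set (eta := k * (eps / 2) ^ 2 * de / 2).
assert (Heta : 0 < eta).
{ unfold eta; assert (0 < (eps / 2) ^ 2) by (apply pow_lt; lra).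
  assert (0 < k * (eps / 2) ^ 2) by nra. nra. }
destruct (proj1 (is_lim_p_infty_spec J l) HJ eta Heta) as [T HT].
exists (Rmax 0 T); intros t Ht.
assert (0 < t) by (pose proof (Rmax_l 0 T); lra).
assert (T < t) by (pose proof (Rmax_r 0 T); lra).
apply Rnot_le_lt; intro Hbig.
assert (Hinc : k * (eps / 2) ^ 2 * (t + de - t) <= J (t + de) - J t).
{ apply (increment_lower_bound J dJ); [lra | intros; apply HdJ; lra |].
  intros r Hr; apply Rle_trans with (2 := Hdis r ltac:(lra)).
  apply Rmult_le_compat_l; [lra |].
  assert (H1 : - M * (r - t) <= g r - g t).
  { apply (increment_lower_bound g dg); [lra | intros; apply Hdg; lra |].
    intros; apply HMg; lra. }
  assert (H2 : - M * (r - t) <= - g r - - g t).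
  { apply (increment_lower_bound (fun t => - g t) (fun t => - dg t)); [lra | |].
    - intros; apply (is_derive_opp (V := R_NormedModule)), Hdg; lra.
    - intros u Hu; specialize (HMg u ltac:(lra)); lra. }
  assert (M * (r - t) <= M * de) by (apply Rmult_le_compat_l; lra).
  revert Hbig; unfold Rabs; destruct (Rcase_abs (g t - c)); intros; nra. }
pose proof (HT t ltac:(lra)) as A1.
pose proof (HT (t + de) ltac:(lra)) as A2.
apply Rabs_def2 in A1; apply Rabs_def2 in A2.
unfold eta in *; lra.
Qed.

(** On [[t, t + 1]] the mean value theorem makes some value of [df] equal to [f (t + 1) - f t],
    which is small for late [t]. *)
Lemma derivative_limit_zero (f df : R -> R) (l m : R) :
  (forall t, is_derive f t (df t)) ->
  is_lim f p_infty l -> is_lim df p_infty m -> m = 0.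
Proof.
intros Hd Hf Hm.
apply Rminus_diag_uniq, Rabs_eq_0, Rle_antisym; [| apply Rabs_pos].
apply le_epsilon; intros eps He; rewrite Rplus_0_l, Rminus_0_r.
destruct (proj1 (is_lim_p_infty_spec f l) Hf (eps / 3) ltac:(lra)) as [T1 H1].
destruct (proj1 (is_lim_p_infty_spec df m) Hm (eps / 3) ltac:(lra)) as [T2 H2].
set (t := Rmax T1 T2 + 1).
pose proof (Rmax_l T1 T2); pose proof (Rmax_r T1 T2).
destruct (MVT_gen f t (t + 1) df) as [c [Hc E]].
- intros; apply Hd.
- intros u _; apply continuity_pt_filterlim, (ex_derive_continuous (V := R_NormedModule)).
  eexists; apply Hd.
- rewrite Rmin_left, Rmax_right in Hc by lra.
  pose proof (H1 t ltac:(unfold t; lra)) as A1.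
  pose proof (H1 (t + 1) ltac:(unfold t; lra)) as A2.
  pose proof (H2 c ltac:(unfold t in *; lra)) as A3.
  apply Rabs_def2 in A1; apply Rabs_def2 in A2; apply Rabs_def2 in A3.
  apply Rabs_le; lra.
Qed.

Lemma is_lim_exp_decay (f : R -> R) (K l : R) :
  0 < l -> (forall t, 0 <= t -> Rabs (f t) <= K * exp (- (l * t))) ->
  is_lim f p_infty 0.
Proof.
intros Hl Hb.
assert (HK : 0 <= K).
{ pose proof (Hb 0 ltac:(lra)) as H; rewrite Rmult_0_r, Ropp_0, exp_0 in H.
  pose proof (Rabs_pos (f 0)); lra. }
apply is_lim_p_infty_spec; intros eps He.
(* Since [exp (l t) > l t], the bound [K exp (- l t)] is below [eps] as soon as [K < l t eps]. *)
exists (K / (l * eps)); intros t Ht.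
assert (0 < l * eps) by nra.
assert (Ht0 : 0 < t).
{ apply Rle_lt_trans with (2 := Ht); apply Rdiv_le_0_compat; lra. }
assert (HKt : K < t * (l * eps)).
{ apply (Rmult_lt_compat_r (l * eps)) in Ht; [| lra].
  replace (K / (l * eps) * (l * eps)) with K in Ht by (field; nra); lra. }
rewrite Rminus_0_r; apply Rle_lt_trans with (1 := Hb t ltac:(lra)).
rewrite exp_Ropp.
assert (Hexp : l * t < exp (l * t)) by (pose proof (exp_ineq1_le (l * t)); lra).
apply (Rmult_lt_reg_r (exp (l * t))); [apply exp_pos |].
rewrite Rmult_assoc, Rinv_l by (pose proof (exp_pos (l * t)); lra).
nra.
Qed.

(** * Rotating variables and a priori bounds *)

Ltac rewrite_Derive D :=
  match type of D with is_derive ?f ?t ?l =>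
    let E := fresh in
    assert (E : Derive (fun u : R => f u) t = l) by exact (is_derive_unique f t l D);
    rewrite ?E; clear E
  end.

(** The constraint and the signs are carried along with the equations. With [s = N2 + N3] and
    [z = sqrt 3 / 2 * (N2 - N3)] one has [s^2 - 4/3 z^2 = 4 N2 N3], so the last inequality encodes
    [N2 N3 > 0]. *)
Definition reduced_system (a s z x y : R -> R) : Prop :=
  forall t : R,
    is_derive a t ((WH_q (x t) (y t) - 4 * x t) * a t) /\
    is_derive s t ((WH_q (x t) (y t) + 2 * x t) * s t + 4 * y t * z t) /\
    is_derive z t ((WH_q (x t) (y t) + 2 * x t) * z t + 3 * y t * s t) /\
    is_derive x t (- (2 - WH_q (x t) (y t)) * x t - 2 * z t ^ 2 + 3 * a t ^ 2
                   + 3 / 2 * (a t * s t)) /\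
    is_derive y t (- (2 - WH_q (x t) (y t)) * y t - 3 * z t * (a t + s t)) /\
    x t ^ 2 + y t ^ 2 + z t ^ 2 + 3 / 4 * a t ^ 2 + 3 / 2 * (a t * s t) = 1 /\
    0 < a t /\ 0 < s t /\ 4 / 3 * z t ^ 2 < s t ^ 2.

(* [z] is rescaled so that [sqrt 3] disappears from the equations. *)
Lemma WH_reduced (N1 N2 N3 Sp Sm : R -> R) :
  WH_system N1 N2 N3 Sp Sm -> WH_constraint N1 N2 N3 Sp Sm ->
  (forall t, N1 t < 0) -> (forall t, 0 < N2 t) -> (forall t, 0 < N3 t) ->
  reduced_system (fun t => - N1 t) (fun t => N2 t + N3 t)
    (fun t => sqrt 3 / 2 * (N2 t - N3 t)) Sp Sm.
Proof.
intros Hs Hc H1 H2 H3 t.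
destruct (Hs t) as (D1 & D2 & D3 & Dp & Dm).
assert (S3 : sqrt 3 * sqrt 3 = 3) by (apply sqrt_def; lra).
specialize (Hc t); specialize (H1 t); specialize (H2 t); specialize (H3 t).
assert (Z2 : (sqrt 3 / 2 * (N2 t - N3 t)) ^ 2 = 3 / 4 * (N2 t - N3 t) ^ 2).
{ replace ((sqrt 3 / 2 * (N2 t - N3 t)) ^ 2)
    with (sqrt 3 * sqrt 3 * (N2 t - N3 t) ^ 2 / 4) by field.
  rewrite S3; field. }
assert (X1 : ex_derive N1 t) by (eexists; apply D1).
assert (X2 : ex_derive N2 t) by (eexists; apply D2).
assert (X3 : ex_derive N3 t) by (eexists; apply D3).
unfold WH_Splus in Dp; unfold WH_Sminus in Dm.
refine (conj _ (conj _ (conj _ (conj _ (conj _ (conj _ (conj _ (conj _ _)))))))).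
1-5: clear Hc H1 H2 H3.
- auto_derive; [auto |].
  rewrite_Derive D1; ring.
- auto_derive; [auto |].
  rewrite_Derive D2; rewrite_Derive D3; field.
- auto_derive; [auto |].
  rewrite_Derive D2; rewrite_Derive D3.
  replace (sqrt 3 / 2 * (N2 t - N3 t)) with (sqrt 3 * ((N2 t - N3 t) / 2)) by field.
  set (A := WH_q _ _) in *.
  (* The two sides agree only modulo [sqrt 3 * sqrt 3 = 3], so their difference is exhibited as a
     multiple of [sqrt 3 * sqrt 3 - 3]. *)
  apply Rminus_diag_uniq.
  match goal with |- ?e = 0 =>
    replace e with ((sqrt 3 * sqrt 3 - 3) * (Sm t * (N2 t + N3 t))) by field end.
  rewrite S3; ring.
- rewrite Z2; match type of Dp with is_derive _ _ ?e => match goal with |- is_derive _ _ ?e' =>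
    replace e' with e by field end end; exact Dp.
- match type of Dm with is_derive _ _ ?e => match goal with |- is_derive _ _ ?e' =>
    replace e' with e by field end end; exact Dm.
- rewrite Z2; lra.
- lra.
- lra.
- rewrite Z2; nra.
Qed.

(** As [a s > 0], every term on the left of the constraint is nonnegative, hence at most 1. *)
Lemma reduced_bounds (a s z x y : R -> R) :
  reduced_system a s z x y ->
  forall t, -1 <= x t <= 1 /\ -1 <= y t <= 1 /\ -1 <= z t <= 1 /\ a t <= 2 /\
    0 < a t * s t <= 2 / 3 /\ 0 <= WH_q (x t) (y t) <= 2.
Proof.
intros H t; destruct (H t) as (_ & _ & _ & _ & _ & Hc & Ha & Hs & _).
assert (0 < a t * s t) by nra.
unfold WH_q; repeat split; nra.
Qed.

(** * Averaging of the rotation and exponential growth of [s] *)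

(** The rotation terms [3 y s] in [z'] and [- 3 z s] in [y'] survive division by [s] and give
    [3 (y^2 - z^2)]. The common rate [q + 2 x] of [z] and [s] cancels, and every remaining term
    carries a factor [1 / s]. *)
Lemma is_derive_yz_div_s (a s z x y : R -> R) :
  reduced_system a s z x y ->
  forall t, is_derive (fun t => y t * z t / s t) t
    (- (2 - WH_q (x t) (y t)) * (y t * z t / s t) + 3 * y t ^ 2
     - 3 * z t ^ 2 * (1 + a t / s t) - 4 * (y t * z t / s t) ^ 2).
Proof.
intros H t; destruct (H t) as (Da & Ds & Dz & Dx & Dy & Hc & Ha & Hs & _).
assert (X1 : ex_derive s t) by (eexists; apply Ds).
assert (X2 : ex_derive y t) by (eexists; apply Dy).
assert (X3 : ex_derive z t) by (eexists; apply Dz).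
auto_derive; [repeat split; auto; lra |].
rewrite_Derive Ds; rewrite_Derive Dz; rewrite_Derive Dy.
field; lra.
Qed.

(** In the original variables the argument of [ln] is [- 4 N1 N2 N3]; the shear terms of the three
    logarithmic rates add up to zero. *)
Lemma is_derive_ln_a_s2 (a s z x y : R -> R) :
  reduced_system a s z x y ->
  forall t, is_derive (fun t => ln (a t * (s t ^ 2 - 4 / 3 * z t ^ 2))) t
    (3 * WH_q (x t) (y t)).
Proof.
intros H t; destruct (H t) as (Da & Ds & Dz & Dx & Dy & Hc & Ha & Hs & Hz).
assert (X1 : ex_derive s t) by (eexists; apply Ds).
assert (X2 : ex_derive a t) by (eexists; apply Da).
assert (X3 : ex_derive z t) by (eexists; apply Dz).
assert (Hp : 0 < a t * (s t ^ 2 - 4 / 3 * z t ^ 2)) by nra.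
auto_derive; [repeat split; auto; simpl in *; lra |].
rewrite_Derive Ds; rewrite_Derive Dz; rewrite_Derive Da.
field; simpl in *; nra.
Qed.

Lemma s_exponential_growth (a s z x y : R -> R) :
  reduced_system a s z x y ->
  exists K l : R, 0 < K /\ 0 < l /\ forall t, 0 <= t -> / s t <= K * exp (- (l * t)).
Proof.
intros H.
pose (P := fun t => a t * (s t ^ 2 - 4 / 3 * z t ^ 2)).
pose (G := fun t => y t * z t / s t).
assert (HP : forall t, 0 < P t <= 2 / 3 * s t).
{ intros t; destruct (H t) as (_ & _ & _ & _ & _ & Hc & Ha & Hs & Hz).
  destruct (reduced_bounds _ _ _ _ _ H t) as (_ & _ & _ & _ & Has & _).
  unfold P; split; [nra |].
  apply Rle_trans with (a t * s t * s t); [| nra].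
  assert (0 <= a t * z t ^ 2) by (apply Rmult_le_pos; nra). nra. }
assert (HlnP : forall t, 0 <= t -> ln (P 0) <= ln (P t)).
{ intros t Ht.
  pose proof (increment_lower_bound (fun t => ln (P t)) _ 0 0 t Ht
    (fun u _ => is_derive_ln_a_s2 _ _ _ _ _ H u)) as Hi.
  assert (0 * (t - 0) <= ln (P t) - ln (P 0)); [| lra].
  apply Hi; intros u _.
  destruct (reduced_bounds _ _ _ _ _ H u) as (_ & _ & _ & _ & _ & Hq); lra. }
assert (HP0 : forall t, 0 <= t -> P 0 <= P t).
{ intros t Ht; destruct (HlnP t Ht) as [Hl | He].
  - left; apply ln_lt_inv; auto; apply HP.
  - right; apply ln_inv; auto; apply HP. }
set (s0 := 3 / 2 * P 0).
assert (Hs0 : 0 < s0) by (unfold s0; specialize (HP 0); lra).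
assert (Hss : forall t, 0 <= t -> s0 <= s t).
{ intros t Ht; specialize (HP0 t Ht); specialize (HP t); unfold s0; lra. }
set (B := / s0 ^ 2).
assert (HB : 0 < B) by (apply Rinv_0_lt_compat, pow_lt, Hs0).
assert (HGb : forall t, -1 <= G t <= 1).
{ intros t; destruct (H t) as (_ & _ & _ & _ & _ & _ & _ & Hs & Hz).
  destruct (reduced_bounds _ _ _ _ _ H t) as (_ & Hy & _).
  assert (Hr : -1 <= z t / s t <= 1).
  { split; [apply Rle_div_r | apply Rle_div_l]; nra. }
  unfold G, Rdiv; rewrite Rmult_assoc; fold (z t / s t); split; nra. }
(* After elimination of [a s] by the constraint, [x'] contains [1 - x^2 - y^2 - 3 z^2]. The part
   [9/2 (z^2 - y^2)] of [- 3/2 G'] leaves [3/2 z^2], which pays for the [z^2] in the bound on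
   [(2 - q) G]. What is lost is at most [1/4 + 5 x^2 + (11/2 + 3/2 B) y^2]; its quadratic part is
   covered by [C q = 2 C (x^2 + y^2)], and [1 - 1/4] is the rate [3/4]. *)
set (C := 3 + B).
pose (F := fun t => x t - 3 / 2 * G t + C / 3 * ln (P t)).
assert (HF : forall t, 0 <= t -> 3 / 4 * (t - 0) <= F t - F 0).
{ intros t Ht.
  apply (increment_lower_bound F (fun u =>
    (- (2 - WH_q (x u) (y u)) * x u - 2 * z u ^ 2 + 3 * a u ^ 2 + 3 / 2 * (a u * s u))
    - 3 / 2 * (- (2 - WH_q (x u) (y u)) * G u + 3 * y u ^ 2
     - 3 * z u ^ 2 * (1 + a u / s u) - 4 * G u ^ 2) + C / 3 * (3 * WH_q (x u) (y u)))); auto.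
  - intros u _; destruct (H u) as (_ & _ & _ & Dx & _).
    apply (is_derive_plus (V := R_NormedModule)).
    + apply (is_derive_minus (V := R_NormedModule)); [exact Dx |].
      apply is_derive_scal, (is_derive_yz_div_s _ _ _ _ _ H).
    + apply is_derive_scal, (is_derive_ln_a_s2 _ _ _ _ _ H).
  - intros u [Hu _]; specialize (Hss u Hu).
    destruct (H u) as (_ & _ & _ & _ & _ & Hc & Ha & Hs & Hz).
    destruct (reduced_bounds _ _ _ _ _ H u) as (Hx & Hy & _ & _ & Has & Hq).
    (* This is [2 |x| <= 1/4 + 4 x^2], from the square of [2 |x| - 1/2]. *)
    assert (Hx' : (2 - WH_q (x u) (y u)) * x u <= / 4 + 4 * x u ^ 2).
    { assert (x u <= Rabs (x u)) by apply RRle_abs.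
      rewrite <- (pow2_abs (x u)).
      pose proof (pow2_ge_0 (2 * Rabs (x u) - / 2)).
      pose proof (Rabs_pos (x u)).
      apply Rle_trans with (2 * Rabs (x u)); [| nra].
      apply Rle_trans with ((2 - WH_q (x u) (y u)) * Rabs (x u)).
      - apply Rmult_le_compat_l; lra.
      - apply Rmult_le_compat_r; lra. }
    assert (HBs : / s u ^ 2 <= B).
    { apply Rinv_le_contravar; [apply pow_lt, Hs0 | apply pow_incr; lra]. }
    (* [|2 G| <= z^2 + y^2 / s^2], by AM-GM *)
    assert (HG' : - (2 - WH_q (x u) (y u)) * G u <= z u ^ 2 + B * y u ^ 2).
    { assert (E : G u = z u * (y u * / s u)) by (unfold G, Rdiv; ring).
      assert (HE : (y u * / s u) ^ 2 <= B * y u ^ 2).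
      { rewrite Rpow_mult_distr, pow_inv, Rmult_comm.
        apply Rmult_le_compat_r; [apply pow2_ge_0 | exact HBs]. }
      rewrite E; set (v := y u * / s u) in *.
      pose proof (pow2_ge_0 (z u + v)).
      pose proof (pow2_ge_0 (z u)); pose proof (pow2_ge_0 v).
      apply Rle_trans with (z u ^ 2 + v ^ 2); [| lra].
      set (m := z u * v); assert (- 2 * m <= z u ^ 2 + v ^ 2) by (unfold m; lra).
      destruct (Rle_dec 0 m).
      - pose proof (Rmult_le_pos (2 - WH_q (x u) (y u)) m ltac:(lra) ltac:(lra)); lra.
      - pose proof (Rmult_le_pos (WH_q (x u) (y u)) (- m) ltac:(lra) ltac:(lra)); lra. }
    assert (Hz' : 3 * z u ^ 2 <= 3 * z u ^ 2 * (1 + a u / s u)).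
    { assert (0 < a u / s u) by (apply Rdiv_lt_0_compat; lra).
      pose proof (Rmult_le_pos (z u ^ 2) (a u / s u) (pow2_ge_0 _) ltac:(lra)). lra. }
    assert (Hq2 : WH_q (x u) (y u) = 2 * (x u ^ 2 + y u ^ 2)) by reflexivity.
    set (q := WH_q (x u) (y u)) in *.
    assert (0 <= B * x u ^ 2) by nra.
    assert (0 <= B * y u ^ 2) by nra.
    unfold C. nra. }
assert (HC : 0 < C) by (unfold C; lra).
(* Since [|x|] and [|G|] are at most 1, the part [x - 3/2 G] of [F] varies by at most 5; dividing
   [C/3 (ln P t - ln P 0) >= 3/4 t - 5] by [C/3] gives both constants. The factor [2/3] comes from
   [P <= 2/3 s]. *)
exists (2 / 3 * exp (15 / C - ln (P 0))), (9 / 4 / C).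
split; [| split].
- apply Rmult_lt_0_compat; [lra | apply exp_pos].
- apply Rdiv_lt_0_compat; lra.
- intros t Ht; rewrite Rmult_assoc, <- exp_plus.
  assert (Hl : - ln (P t) <= 15 / C - ln (P 0) + - (9 / 4 / C * t)).
  { specialize (HF t Ht); unfold F in HF.
    destruct (reduced_bounds _ _ _ _ _ H t) as (Hx & _).
    destruct (reduced_bounds _ _ _ _ _ H 0) as (Hx0 & _).
    pose proof (HGb t); pose proof (HGb 0).
    apply (Rmult_le_reg_l (C / 3)); [lra |].
    replace (C / 3 * (15 / C - ln (P 0) + - (9 / 4 / C * t)))
      with (5 - C / 3 * ln (P 0) - 3 / 4 * t) by (field; lra).
    lra. }
  apply Rle_trans with (2 / 3 * exp (- ln (P t))).
  + rewrite exp_Ropp, exp_ln by apply HP.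
    destruct (HP t) as [Hp1 Hp2].
    replace (2 / 3 * / P t) with (/ (3 / 2 * P t)) by (field; lra).
    apply Rinv_le_contravar; lra.
  + apply Rmult_le_compat_l; [lra |].
    destruct Hl as [Hl | ->]; [left; apply exp_increasing, Hl | lra].
Qed.

(** * Convergence of [x] and of [a s] by a Lyapunov function *)

Lemma is_lim_mult_finite (f g : R -> R) (l m : R) :
  is_lim f p_infty l -> is_lim g p_infty m ->
  is_lim (fun t => f t * g t) p_infty (l * m).
Proof. intros Hf Hg; exact (is_lim_mult f g p_infty l m Hf Hg I). Qed.

Ltac is_lim_arith :=
  repeat (assumption || apply is_lim_const || apply is_lim_minus' || apply is_lim_plus'
          || apply is_lim_mult_finite).

(** In the original variables the first logarithm is that of [4 N1^2 N2 N3], with derivative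
    [4 (q - x)]. Adding [4 x' / (2 - x)] and eliminating [a s] by the constraint cancels the cubic
    terms [q x], and the rest in [x] completes to [(1 - 2 x)^2]. *)
Lemma is_derive_dissipation (a s z x y : R -> R) :
  reduced_system a s z x y ->
  forall t, is_derive
    (fun t => ln (a t ^ 2 * (s t ^ 2 - 4 / 3 * z t ^ 2)) - 4 * ln (2 - x t)) t
    (4 / (2 - x t) * ((1 - 2 * x t) ^ 2 + 9 / 4 * a t ^ 2 + 3 * (y t ^ 2 - z t ^ 2))).
Proof.
intros H t; destruct (H t) as (Da & Ds & Dz & Dx & Dy & Hc & Ha & Hs & Hz).
destruct (reduced_bounds _ _ _ _ _ H t) as (Hx & _).
assert (X1 : ex_derive s t) by (eexists; apply Ds).
assert (X2 : ex_derive a t) by (eexists; apply Da).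
assert (X3 : ex_derive z t) by (eexists; apply Dz).
assert (X4 : ex_derive x t) by (eexists; apply Dx).
assert (Hp : 0 < a t ^ 2 * (s t ^ 2 - 4 / 3 * z t ^ 2))
  by (apply Rmult_lt_0_compat; [apply pow_lt |]; lra).
auto_derive; [repeat split; auto; simpl in *; lra |].
rewrite_Derive Ds; rewrite_Derive Dz; rewrite_Derive Da; rewrite_Derive Dx.
replace (3 / 2 * (a t * s t)) with
  (1 - (x t ^ 2 + y t ^ 2 + z t ^ 2 + 3 / 4 * a t ^ 2)) by lra.
unfold WH_q; field; repeat split; simpl in *; nra.
Qed.

Lemma reduced_x_derivative_bounded (a s z x y : R -> R) :
  reduced_system a s z x y -> forall t,
  -20 <= - (2 - WH_q (x t) (y t)) * x t - 2 * z t ^ 2 + 3 * a t ^ 2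
         + 3 / 2 * (a t * s t) <= 20.
Proof.
intros H t; destruct (H t) as (_ & _ & _ & _ & _ & _ & Ha & _).
destruct (reduced_bounds _ _ _ _ _ H t) as (Hx & _ & Hz & Ha2 & Has & Hq).
split; nra.
Qed.

Lemma reduced_convergence (a s z x y : R -> R) :
  reduced_system a s z x y ->
  is_lim a p_infty 0 /\ is_lim (fun t => / s t) p_infty 0 /\
  is_lim x p_infty (/ 2) /\ exists u : R, is_lim (fun t => a t * s t) p_infty u.
Proof.
intros H.
destruct (s_exponential_growth _ _ _ _ _ H) as (K & l & HK & Hl & Hs).
pose (G := fun t => y t * z t / s t).
assert (HGs : forall t, Rabs (G t) <= / s t).
{ intros t; destruct (H t) as (_ & _ & _ & _ & _ & _ & _ & Hst & _).
  destruct (reduced_bounds _ _ _ _ _ H t) as (_ & Hy & Hz & _).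
  unfold G, Rdiv; rewrite Rabs_mult, (Rabs_pos_eq (/ s t))
    by (left; apply Rinv_0_lt_compat, Hst).
  rewrite <- (Rmult_1_l (/ s t)) at 2.
  apply Rmult_le_compat_r; [left; apply Rinv_0_lt_compat, Hst |].
  apply Rabs_le; split; nra. }
assert (HsL : is_lim (fun t => / s t) p_infty 0).
{ apply (is_lim_exp_decay _ K l Hl); intros t Ht.
  destruct (H t) as (_ & _ & _ & _ & _ & _ & _ & Hst & _).
  rewrite Rabs_pos_eq; [auto | left; apply Rinv_0_lt_compat, Hst]. }
assert (HGL : is_lim G p_infty 0).
{ apply (is_lim_exp_decay _ K l Hl); intros t Ht.
  apply Rle_trans with (1 := HGs t); auto. }
assert (HaL : is_lim a p_infty 0).
{ apply (is_lim_exp_decay _ K l Hl); intros t Ht.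
  destruct (H t) as (_ & _ & _ & _ & _ & _ & Ha & Hst & _).
  destruct (reduced_bounds _ _ _ _ _ H t) as (_ & _ & _ & _ & Has & _).
  apply Rle_trans with (2 := Hs t Ht).
  rewrite Rabs_pos_eq by lra.
  apply (Rmult_le_reg_r (s t)); [lra |]; rewrite Rinv_l; lra. }
(* Subtracting [eps] adds [100 K exp (- l t)] to the derivative of [J]. This dominates the errors of
   indefinite sign, at most [8 |G|] from [(2 - q) G] and [80 |G|] from the [dx] term. *)
pose (eps := fun t => 100 * K / l * exp (- (l * t))).
pose (L := fun t => ln (a t ^ 2 * (s t ^ 2 - 4 / 3 * z t ^ 2)) - 4 * ln (2 - x t)).
pose (J := fun t => L t - 4 * G t / (2 - x t) - eps t).
pose (dx := fun t => - (2 - WH_q (x t) (y t)) * x t - 2 * z t ^ 2 + 3 * a t ^ 2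
         + 3 / 2 * (a t * s t)).
(* The derivative of [4 G / (2 - x)] has removed [3 (y^2 - z^2)]; the terms in [a / s] and [G^2]
   that it leaves behind are nonnegative. *)
pose (dJ := fun t => 4 / (2 - x t) * ((1 - 2 * x t) ^ 2 + 9 / 4 * a t ^ 2
    + (2 - WH_q (x t) (y t)) * G t + 3 * z t ^ 2 * (a t / s t) + 4 * G t ^ 2)
    - 4 * G t * dx t / (2 - x t) ^ 2 + 100 * K * exp (- (l * t))).
assert (HdJ : forall t, is_derive J t (dJ t)).
{ intros t.
  pose proof (is_derive_dissipation _ _ _ _ _ H t : is_derive L t _) as DL.
  pose proof (is_derive_yz_div_s _ _ _ _ _ H t : is_derive G t _) as DG.
  change (y t * z t / s t) with (G t) in DG.
  destruct (H t) as (_ & _ & _ & Dx & _ & _ & _ & Hst & _); fold (dx t) in Dx.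
  destruct (reduced_bounds _ _ _ _ _ H t) as (Hx & _).
  assert (X1 : ex_derive L t) by (eexists; apply DL).
  assert (X2 : ex_derive G t) by (eexists; apply DG).
  assert (X3 : ex_derive x t) by (eexists; apply Dx).
  unfold J, eps; auto_derive; [repeat split; auto; lra |].
  rewrite_Derive DL; rewrite_Derive DG; rewrite_Derive Dx.
  unfold dJ. field; repeat split; lra. }
assert (Hdis : forall t, 0 <= t -> 1 * (x t - / 2) ^ 2 <= dJ t).
{ intros t Ht; specialize (Hs t Ht); specialize (HGs t).
  pose proof (reduced_x_derivative_bounded _ _ _ _ _ H t) as Hdx; fold (dx t) in Hdx.
  destruct (H t) as (_ & _ & _ & _ & _ & _ & Ha & Hst & _).
  destruct (reduced_bounds _ _ _ _ _ H t) as (Hx & _ & _ & _ & _ & Hq).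
  assert (Hi : / 3 <= / (2 - x t) <= 1).
  { split; [| rewrite <- Rinv_1]; apply Rinv_le_contravar; lra. }
  assert (Hz : 0 <= z t ^ 2 * (a t / s t)).
  { apply Rmult_le_pos; [apply pow2_ge_0 |].
    left; apply Rdiv_lt_0_compat; lra. }
  assert (Hg : Rabs (G t) <= K * exp (- (l * t))) by lra.
  unfold dJ, Rdiv in *; rewrite <- pow_inv.
  set (i := / (2 - x t)) in *.
  set (g := Rabs (G t)) in *.
  assert (Hg0 : 0 <= g) by apply Rabs_pos.
  assert (Hgg : - g <= G t <= g) by (unfold g, Rabs; destruct (Rcase_abs (G t)); lra).
  assert (A1 : - (2 * g) <= (2 - WH_q (x t) (y t)) * G t) by nra.
  assert (A2 : 4 * G t * dx t * i ^ 2 <= 80 * g).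
  { assert (B1 : 0 <= i ^ 2 <= 1) by (split; nra).
    assert (B2 : G t * dx t <= 20 * g) by nra.
    nra. }
  assert (A3 : 4 * i * (- (2 * g)) >= - (8 * g)) by nra.
  assert (A4 : 4 * i * (1 - 2 * x t) ^ 2 >= (x t - / 2) ^ 2).
  { replace ((1 - 2 * x t) ^ 2) with (4 * (x t - / 2) ^ 2) by field.
    pose proof (pow2_ge_0 (x t - / 2)). nra. }
  pose proof (pow2_ge_0 (a t)); pose proof (pow2_ge_0 (G t)).
  assert (A5 : 4 * i * (- (2 * g) + (1 - 2 * x t) ^ 2) <=
     4 * i * ((1 - 2 * x t) ^ 2 + 9 * / 4 * a t ^ 2 +
      (2 - WH_q (x t) (y t)) * G t + 3 * z t ^ 2 * (a t * / s t) + 4 * G t ^ 2)).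
  { apply Rmult_le_compat_l; lra. }
  lra. }
assert (HJL : exists j : R, is_lim J p_infty j).
(* Here [L <= 0], because [a s < 1] and [2 - x >= 1], and [|G| <= K] bounds the correction by
   [4 K]. *)
{ apply (is_lim_nondecreasing_bounded J (4 * K)).
  - intros u v Huv.
    pose proof (increment_lower_bound J dJ 0 u v ltac:(lra) (fun t _ => HdJ t)) as Hi.
    assert (0 * (v - u) <= J v - J u); [| lra].
    apply Hi; intros t Ht.
    apply Rle_trans with (2 := Hdis t ltac:(lra)).
    rewrite Rmult_1_l; apply pow2_ge_0.
  - intros t Ht; specialize (Hs t Ht); specialize (HGs t).
    destruct (H t) as (_ & _ & _ & _ & _ & _ & Ha & Hst & Hz).
    destruct (reduced_bounds _ _ _ _ _ H t) as (Hx & _ & _ & _ & Has & _).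
    assert (He : 0 <= eps t).
    { apply Rmult_le_pos; [| left; apply exp_pos].
      apply Rdiv_le_0_compat; lra. }
    assert (He1 : exp (- (l * t)) <= 1).
    { rewrite <- exp_0; destruct (Req_dec t 0) as [-> | ].
      - rewrite Rmult_0_r, Ropp_0; lra.
      - left; apply exp_increasing; nra. }
    assert (HGK : Rabs (G t) <= K) by nra.
    assert (B1 : ln (a t ^ 2 * (s t ^ 2 - 4 / 3 * z t ^ 2)) <= 0).
    { rewrite <- ln_1; apply ln_le.
      - apply Rmult_lt_0_compat; [apply pow_lt |]; lra.
      - apply Rle_trans with ((a t * s t) ^ 2); [| nra].
        rewrite Rpow_mult_distr.
        apply Rmult_le_compat_l; [apply pow2_ge_0 |].
        pose proof (pow2_ge_0 (z t)); lra. }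
    assert (B2 : 0 <= ln (2 - x t)) by (rewrite <- ln_1; apply ln_le; lra).
    assert (B3 : - (4 * G t / (2 - x t)) <= 4 * K).
    { apply Rle_trans with (Rabs (G t) * 4 / (2 - x t)).
      - unfold Rdiv; rewrite <- Ropp_mult_distr_l_reverse.
        apply Rmult_le_compat_r; [left; apply Rinv_0_lt_compat; lra |].
        unfold Rabs; destruct (Rcase_abs (G t)); lra.
      - apply Rle_div_l; [lra |]. nra. }
    unfold J, L; lra. }
destruct HJL as [j HJL].
assert (HxL : is_lim x p_infty (/ 2)).
{ apply (is_lim_of_dissipation J dJ x dx 1 20 _ j); try lra; auto.
  - intros t _; apply (H t).
  - intros t _; apply (reduced_x_derivative_bounded _ _ _ _ _ H). }
repeat (apply conj; [assumption |]).
assert (HeL : is_lim eps p_infty 0).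
{ apply (is_lim_exp_decay _ (100 * K / l) l Hl); intros t Ht.
  rewrite Rabs_pos_eq; [unfold eps; lra |].
  apply Rmult_le_pos; [apply Rdiv_le_0_compat; lra | left; apply exp_pos]. }
assert (Hi : is_lim (fun t => / (2 - x t)) p_infty (/ (2 - / 2))).
{ apply (is_lim_inv (fun t => 2 - x t) p_infty (2 - / 2)).
  - apply is_lim_minus'; [apply is_lim_const | exact HxL].
  - intros E; injection E; lra. }
assert (HlnQ : is_lim (fun t => ln (a t ^ 2 * (s t ^ 2 - 4 / 3 * z t ^ 2))) p_infty
  (j + 0 + 4 * 0 * / (2 - / 2) + 4 * ln (2 - / 2))).
{ apply (is_lim_ext (fun t => J t + eps t + 4 * G t * / (2 - x t) + 4 * ln (2 - x t))).
  - intros t; unfold J, L, Rdiv; ring.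
  - apply is_lim_plus'; [apply is_lim_plus'; [apply is_lim_plus'; assumption |] |].
    + apply is_lim_mult_finite; [| exact Hi].
      apply is_lim_mult_finite; [apply is_lim_const | exact HGL].
    + apply is_lim_mult_finite; [apply is_lim_const |].
      apply (is_lim_comp_continuous (fun t => 2 - x t) ln p_infty (2 - / 2)).
      * apply is_lim_minus'; [apply is_lim_const | exact HxL].
      * apply (ex_derive_continuous (V := R_NormedModule)).
        eexists; apply is_derive_ln; lra. }
set (m := j + _ + _ + _) in HlnQ.
exists (sqrt (exp m)).
(* The product [a s] is recovered from the convergent logarithm: [(a s)^2] differs from its
   exponential by [4/3 a^2 z^2], which decays because [a^2 <= 2 / s]. *)
apply (is_lim_ext (fun t => sqrt (exp (ln (a t ^ 2 * (s t ^ 2 - 4 / 3 * z t ^ 2)))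
   + 4 / 3 * ((a t * a t) * (z t * z t))))).
{ intros t; destruct (H t) as (_ & _ & _ & _ & _ & _ & Ha & Hst & Hz).
  rewrite exp_ln by (apply Rmult_lt_0_compat; [apply pow_lt |]; lra).
  replace (_ + _) with ((a t * s t) ^ 2) by field.
  apply sqrt_pow2; nra. }
apply (is_lim_comp_continuous _ sqrt p_infty (exp m)).
- replace (Finite (exp m)) with (Finite (exp m + 4 / 3 * 0)) by (f_equal; ring).
  apply is_lim_plus'.
  + apply (is_lim_comp_continuous _ exp p_infty m); [exact HlnQ |].
    apply (ex_derive_continuous (V := R_NormedModule)); eexists; apply is_derive_exp.
  + apply is_lim_mult_finite; [apply is_lim_const |].
    apply (is_lim_exp_decay _ (2 * K) l Hl); intros t Ht; specialize (Hs t Ht).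
    destruct (H t) as (_ & _ & _ & _ & _ & _ & Ha & Hst & _).
    destruct (reduced_bounds _ _ _ _ _ H t) as (_ & _ & Hz & Ha2 & Has & _).
    assert (a t <= / s t)
      by (apply (Rmult_le_reg_r (s t)); [lra |]; rewrite Rinv_l; lra).
    assert (0 <= z t * z t <= 1) by nra.
    rewrite Rabs_pos_eq by nra.
    apply Rle_trans with (a t * a t); nra.
- apply continuous_sqrt.
Qed.

(** * Vanishing of the oscillation energy *)

(** By the constraint [y^2 + z^2] tends to [3/4 - 3/2 u], so the value [1/2] of [u] expresses that
    the oscillation dies out. *)
Lemma oscillation_energy_vanishes (a s z x y : R -> R) (u : R) :
  reduced_system a s z x y ->
  is_lim a p_infty 0 -> is_lim (fun t => / s t) p_infty 0 ->
  is_lim x p_infty (/ 2) -> is_lim (fun t => a t * s t) p_infty u ->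
  u = / 2.
Proof.
intros H Ha Hs Hx Hu.
pose (G := fun t => y t * z t / s t).
pose (E := fun t => y t ^ 2 + z t ^ 2).
assert (Hsmall : forall h : R -> R, (forall t, Rabs (h t) <= 6) ->
  is_lim (fun t => h t * / s t) p_infty 0).
{ intros h Hh; apply is_lim_p_infty_spec; intros eps He.
  destruct (proj1 (is_lim_p_infty_spec _ _) Hs (eps / 6) ltac:(lra)) as [T HT].
  exists T; intros t Ht; specialize (HT t Ht); rewrite Rminus_0_r in *.
  rewrite Rabs_mult; pose proof (Rabs_pos (h t)); pose proof (Rabs_pos (/ s t)).
  specialize (Hh t); nra. }
assert (Hyz : forall t, -1 <= y t * z t <= 1).
{ intros t; destruct (reduced_bounds _ _ _ _ _ H t) as (_ & Hy & Hz & _); nra. }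
assert (HG : is_lim G p_infty 0).
{ apply Hsmall; intros t; apply Rabs_le; specialize (Hyz t); lra. }
pose (dx := fun t => - (2 - WH_q (x t) (y t)) * x t - 2 * z t ^ 2 + 3 * a t ^ 2
         + 3 / 2 * (a t * s t)).
pose (Q := fun t => 2 - WH_q (x t) (y t)).
assert (HQ : forall t, 0 <= Q t <= 2).
{ intros t; unfold Q; pose proof (reduced_bounds _ _ _ _ _ H t); lra. }
assert (HdxG : is_lim (fun t => dx t * G t) p_infty 0).
{ apply is_lim_p_infty_spec; intros eps He.
  destruct (proj1 (is_lim_p_infty_spec _ _) HG (eps / 20) ltac:(lra)) as [T HT].
  exists T; intros t Ht; specialize (HT t Ht); rewrite Rminus_0_r in *.
  pose proof (reduced_x_derivative_bounded _ _ _ _ _ H t) as Hd; fold (dx t) in Hd.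
  apply Rabs_le in Hd.
  rewrite Rabs_mult; pose proof (Rabs_pos (dx t)); pose proof (Rabs_pos (G t)); nra. }
assert (HQG : is_lim (fun t => Q t * G t) p_infty 0).
{ apply (is_lim_ext (fun t => Q t * (y t * z t) * / s t));
    [intros t; unfold G, Rdiv; ring |].
  apply Hsmall; intros t; specialize (HQ t); specialize (Hyz t); apply Rabs_le; nra. }
assert (HaG : is_lim (fun t => z t ^ 2 * a t * / s t) p_infty 0).
{ apply Hsmall; intros t.
  destruct (H t) as (_ & _ & _ & _ & _ & _ & Hat & _).
  destruct (reduced_bounds _ _ _ _ _ H t) as (_ & _ & Hz & Ha2 & _).
  assert (0 <= z t ^ 2 <= 1) by (split; nra).
  apply Rabs_le; split; nra. }
(* The oscillating part of [x'] is [2 x y^2 - 2 z^2 = (x - 1) (y^2 + z^2) + (x + 1) (y^2 - z^2)];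
   the correction averages out the second summand. The remainder [Rm] is [y^2 - z^2 - G' / 3]. *)
pose (f := fun t => x t - (x t + 1) * G t * / 3).
pose (Rm := fun t => (Q t * G t) * / 3 + z t ^ 2 * a t * / s t + 4 / 3 * (G t * G t)).
pose (df := fun t => (2 * (x t * x t) - 2) * x t + (x t - 1) * E t
   + 3 * (a t * a t) + 3 / 2 * (a t * s t) - dx t * G t * / 3 + (x t + 1) * Rm t).
assert (Hdf : forall t, is_derive f t (df t)).
{ intros t.
  pose proof (is_derive_yz_div_s _ _ _ _ _ H t : is_derive G t _) as DG.
  change (y t * z t / s t) with (G t) in DG.
  destruct (H t) as (_ & _ & _ & Dx & _ & _ & _ & Hst & _); fold (dx t) in Dx.
  assert (X2 : ex_derive G t) by (eexists; apply DG).
  assert (X3 : ex_derive x t) by (eexists; apply Dx).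
  unfold f; auto_derive; [repeat split; auto; lra |].
  rewrite_Derive DG; rewrite_Derive Dx.
  unfold df, Rm, Q, E.
  replace (1 * dx t) with (- (2 - WH_q (x t) (y t)) * x t - 2 * z t ^ 2 + 3 * a t ^ 2
         + 3 / 2 * (a t * s t)) at 1 by (unfold dx; ring).
  unfold WH_q; field; lra. }
set (e := 1 - (/ 2 * / 2) - 3 / 4 * (0 * 0) - 3 / 2 * u).
assert (HE : is_lim E p_infty e).
{ apply (is_lim_ext (fun t => 1 - x t * x t - 3 / 4 * (a t * a t) - 3 / 2 * (a t * s t))).
  - intros t; destruct (H t) as (_ & _ & _ & _ & _ & Hc & _); unfold E; nra.
  - is_lim_arith. }
assert (HR : is_lim Rm p_infty (0 * / 3 + 0 + 4 / 3 * (0 * 0))).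
{ unfold Rm; is_lim_arith. }
assert (Hf : is_lim f p_infty (/ 2 - (/ 2 + 1) * 0 * / 3)).
{ unfold f; is_lim_arith. }
assert (HDf : is_lim df p_infty ((2 * (/ 2 * / 2) - 2) * / 2 + (/ 2 - 1) * e
  + 3 * (0 * 0) + 3 / 2 * u - 0 * / 3 + (/ 2 + 1) * (0 * / 3 + 0 + 4 / 3 * (0 * 0)))).
{ unfold df; is_lim_arith. }
pose proof (derivative_limit_zero f df _ _ Hdf Hf HDf) as Hz.
unfold e in Hz; lra.
Qed.

(** * Return to the original variables *)

Theorem mainTheorem1 (N1 N2 N3 Sp Sm : R -> R) :
  WH_system N1 N2 N3 Sp Sm ->
  WH_constraint N1 N2 N3 Sp Sm ->
  (forall t : R, N1 t < 0) ->
  (forall t : R, 0 < N2 t) ->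
  (forall t : R, 0 < N3 t) ->
  is_lim N1 p_infty 0 /\
  is_lim N2 p_infty p_infty /\
  is_lim N3 p_infty p_infty /\
  is_lim Sp p_infty (/ 2) /\
  is_lim Sm p_infty 0 /\
  is_lim (fun t => N1 t * (N2 t + N3 t)) p_infty (- / 2) /\
  is_lim (fun t => N2 t - N3 t) p_infty 0.
Proof.
intros Hsys Hc H1 H2 H3.
pose proof (WH_reduced _ _ _ _ _ Hsys Hc H1 H2 H3) as H.
destruct (reduced_convergence _ _ _ _ _ H) as (Ha & Hs & Hx & u & Hu).
assert (Eu : u = / 2) by exact (oscillation_energy_vanishes _ _ _ _ _ _ H Ha Hs Hx Hu).
subst u.
assert (HE : is_lim (fun t => Sm t ^ 2 + 3 / 4 * (N2 t - N3 t) ^ 2) p_infty 0).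
{ replace (Finite 0)
    with (Finite (1 - / 2 * / 2 - 3 / 4 * (0 * 0) - 3 / 2 * / 2)) by (f_equal; field).
  apply (is_lim_ext (fun t => 1 - Sp t * Sp t - 3 / 4 * (- N1 t * - N1 t)
    - 3 / 2 * (- N1 t * (N2 t + N3 t)))).
  - intros t; specialize (Hc t); lra.
  - is_lim_arith. }
(* The factor [1/2] lies below both weights [1] and [3/4], so one statement serves for [Sm] and for
   [N2 - N3]. *)
assert (Hsq : forall h : R -> R,
  (forall t, / 2 * h t ^ 2 <= Sm t ^ 2 + 3 / 4 * (N2 t - N3 t) ^ 2) ->
  is_lim h p_infty 0).
{ intros h Hh; apply is_lim_p_infty_spec; intros eps He.
  destruct (proj1 (is_lim_p_infty_spec _ _) HE (/ 2 * eps ^ 2)) as [T HT];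
    [pose proof (pow_lt eps 2 He); lra |].
  exists T; intros t Ht; specialize (HT t Ht); specialize (Hh t).
  apply Rabs_def2 in HT; rewrite Rminus_0_r.
  apply Rabs_lt_between; split; apply Rnot_le_lt; intro; nra. }
assert (Hy : is_lim Sm p_infty 0).
{ apply Hsq; intros t; pose proof (pow2_ge_0 (N2 t - N3 t)); pose proof (pow2_ge_0 (Sm t)); lra. }
assert (Hd : is_lim (fun t => N2 t - N3 t) p_infty 0).
{ apply Hsq; intros t; pose proof (pow2_ge_0 (N2 t - N3 t)); pose proof (pow2_ge_0 (Sm t)); lra. }
assert (Hbig : forall M, exists T, forall t, T < t -> M < N2 t /\ M < N3 t).
(* If [N2 + N3 > m] and [|N2 - N3| < 1], then each of [N2], [N3] exceeds [(m - 1) / 2 = |M|]. *)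
{ intros M; set (m := 2 * Rabs M + 1).
  assert (Hm : 0 < m) by (pose proof (Rabs_pos M); unfold m; lra).
  destruct (proj1 (is_lim_p_infty_spec _ _) Hs (/ m)) as [T1 HT1];
    [apply Rinv_0_lt_compat, Hm |].
  destruct (proj1 (is_lim_p_infty_spec _ _) Hd 1 ltac:(lra)) as [T2 HT2].
  exists (Rmax T1 T2); intros t Ht.
  pose proof (Rmax_l T1 T2); pose proof (Rmax_r T1 T2).
  specialize (HT1 t ltac:(lra)); specialize (HT2 t ltac:(lra)).
  specialize (H2 t); specialize (H3 t).
  apply Rabs_def2 in HT1; apply Rabs_def2 in HT2.
  assert (m < N2 t + N3 t).
  { rewrite <- (Rinv_inv m), <- (Rinv_inv (N2 t + N3 t)).
    apply Rinv_lt_contravar; [| lra].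
    apply Rmult_lt_0_compat; apply Rinv_0_lt_compat; lra. }
  pose proof (RRle_abs M); unfold m in *; split; lra. }
refine (conj _ (conj _ (conj _ (conj Hx (conj Hy (conj _ Hd)))))).
- apply (is_lim_ext (fun t => - - N1 t)); [intros; ring |].
  rewrite <- Ropp_0; exact (is_lim_opp _ p_infty 0 Ha).
- apply is_lim_spec; intros M; destruct (Hbig M) as [T HT].
  exists T; intros t Ht; apply HT, Ht.
- apply is_lim_spec; intros M; destruct (Hbig M) as [T HT].
  exists T; intros t Ht; apply HT, Ht.
- apply (is_lim_ext (fun t => - (- N1 t * (N2 t + N3 t)))); [intros; ring |].
  exact (is_lim_opp _ p_infty (/ 2) Hu).
Qed.
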